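(* Assume $( * )$, i.e. work in ZF + DC + ''every subset of $2^{\omega}$ has the Baire property''. Then the following hold. (1) Suppose $G$ is a Hausdorff topological group, $(g_n)_{n\in\omega}$ is a sequence in $G$ with $g_n\searrow 1_G$, and $L$ is a length function on $G$. Then the sequence $(L(g_n))_{n\in\omega}$ is bounded. (2) Suppose $X$ is a topological space, $x\in X$, $(l_n)_{n\in\omega}$ is a sequence of loops at $x$ that is deeply concatenable for a subgroup $K\leq\pi_1(X,x)$, and $L$ is a length function on $K$. Then the sequence $(L([l_n]))_{n\in\omega}$ is bounded.
   Context: $( * )$ denotes the theory ZF + DC + ''every subset of the Cantor space $2^{\omega}=\{0,1\}^{\omega}$ (product topology) has the Baire property''; the full axiom of choice is not assumed. DC is the axiom of dependent choice: if $R$ is a binary relation on a nonempty set $X$ with $(\forall x)(\exists y)(xRy)$, then there is a sequence $(z_n)_{n\in\omega}$ with $z_nRz_{n+1}$ for all $n$. A subset $Y$ of a space $X$ has the Baire property if there is an open $U\subseteq X$ such that $Y\Delta U$ is meager in $X$. A length function on a group $G$ is a function $L:G\rightarrow[0,\infty)$ such that $L(1_G)=0$, $L(g)=L(g^{-1})$ and $L(gh)\leq L(g)+L(h)$ for all $g,h\in G$. For a sequence $(g_n)_{n\in\omega}$ in a Hausdorff topological group $G$, $g_n\searrow 1_G$ means that for each $\sigma\in 2^{\omega}$ the sequence $(g_0^{\sigma(0)}\cdots g_{n-1}^{\sigma(n-1)})_{n\in\omega}$ converges in $G$. For loops $(l_n)_{n\in\omega}$ based at $x\in X$, $l_n\searrow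 x$ means that for every open neighborhood $U$ of $x$ there is $N\in\omega$ such that $l_n([0,1])\subseteq U$ for all $n\geq N$. For a loop $l$ at $x$, $l^0$ is the constant loop at $x$ and $l^1=l$. If $l_n\searrow x$ and $\sigma\in 2^{\omega}$, the loop $l^{\sigma}$ is defined by $l^{\sigma}(t)=l_n^{\sigma(n)}(2^{n+1}(t-1)+2)$ for $t\in[1-\frac{1}{2^n},1-\frac{1}{2^{n+1}}]$, $n\in\omega$, and $l^{\sigma}(1)=x$. The sequence $(l_n)_{n\in\omega}$ is deeply concatenable for $K\leq\pi_1(X,x)$ if $l_n\searrow x$ and $[l^{\sigma}]\in K$ for all $\sigma\in 2^{\omega}$. *)

(* Defs.v *)
(* MathComp-Analysis is deliberately avoided: its foundations contain a global
   choice operator, whereas the results stated with these definitions assume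
   the Baire property for all subsets of the Cantor space, which contradicts
   the axiom of choice.  The only axioms behind this file are those of the
   Stdlib reals, functional and propositional extensionality and proof
   irrelevance; all of them
   hold in the set-theoretic interpretation of types over ZF.  No proof should
   use a choice axiom beyond the hypothesis [dependent_choice]. *)
From Stdlib Require Import Reals Lra Lia List.
From Stdlib Require Import FunctionalExtensionality PropExtensionality.
From Stdlib Require Import ProofIrrelevance ConstructiveEpsilon.

Open Scope R_scope.

(** * Topology *)

Record topology (T : Type) : Type := Topology {
  open : (T -> Prop) -> Prop;
  open_full : open (fun _ => True);
  open_inter : forall U V, open U -> open V -> open (fun x => U x /\ V x);
  open_union : forall F : (T -> Prop) -> Prop,
    (forall U, F U -> open U) -> open (fun x => exists U, F U /\ U x) }.
Arguments Topology {T}.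
Arguments open {T}.
Arguments open_full {T}.
Arguments open_inter {T}.
Arguments open_union {T}.

Lemma set_ext {T : Type} (A B : T -> Prop) : (forall x, A x <-> B x) -> A = B.
Proof.
intros H; apply functional_extensionality; intros x.
now apply propositional_extensionality.
Qed.

Lemma open_local {T : Type} (tau : topology T) (A : T -> Prop) :
  (forall x, A x -> exists U, open tau U /\ U x /\ (forall y, U y -> A y)) ->
  open tau A.
Proof.
intros H.
replace A with
  (fun x => exists U, (open tau U /\ forall y, U y -> A y) /\ U x).
- apply open_union; now intros U [HU _].
- apply set_ext; intros x; split.
  + intros [U [[_ HUA] HU]]; now apply HUA.
  + intros Ax; destruct (H x Ax) as [U [HU [Ux HUA]]]; now exists U.
Qed.

Definition continuous {S T : Type} (tS : topology S) (tT : topology T)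
  (f : S -> T) : Prop :=
  forall U, open tT U -> open tS (fun s => U (f s)).

Definition hausdorff {T : Type} (tau : topology T) : Prop :=
  forall x y : T, x <> y -> exists U V,
    open tau U /\ open tau V /\ U x /\ V y /\ forall z, ~ (U z /\ V z).

Definition converges {T : Type} (tau : topology T) (u : nat -> T) (y : T)
  : Prop :=
  forall U, open tau U -> U y ->
    exists N, forall n, (N <= n)%nat -> U (u n).

Program Definition discrete_topology (T : Type) : topology T :=
  Topology (fun _ => True) _ _ _.

Program Definition prod_topology {S T : Type} (tS : topology S)
  (tT : topology T) : topology (S * T) :=
  Topology (fun W => forall p, W p -> exists U V,
              open tS U /\ open tT V /\ U (fst p) /\ V (snd p) /\
              forall q, U (fst q) -> V (snd q) -> W q) _ _ _.
Next Obligation.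
exists (fun _ => True), (fun _ => True).
repeat split; auto using open_full.
Qed.
Next Obligation.
destruct (H _ H1) as [U1 [V1 [oU1 [oV1 [h1 [k1 s1]]]]]].
destruct (H0 _ H2) as [U2 [V2 [oU2 [oV2 [h2 [k2 s2]]]]]].
exists (fun x => U1 x /\ U2 x), (fun x => V1 x /\ V2 x).
split; [now apply open_inter|]; split; [now apply open_inter|].
repeat split; auto; [apply s1 | apply s2]; tauto.
Qed.
Next Obligation.
destruct (H _ H1 _ H2) as [U1 [V1 [oU1 [oV1 [h1 [k1 s1]]]]]].
exists U1, V1; repeat split; auto; intros q hq kq; exists H0; split; auto.
Qed.

Program Definition pi_topology {I : Type} {T : I -> Type}
  (tau : forall i, topology (T i)) : topology (forall i, T i) :=
  Topology (fun W => forall x, W x ->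
              exists (F : list I) (V : forall i, T i -> Prop),
                (forall i, open (tau i) (V i)) /\ (forall i, V i (x i)) /\
                forall y, (forall i, In i F -> V i (y i)) -> W y) _ _ _.
Next Obligation.
exists nil, (fun _ _ => True); repeat split; intros; auto using open_full.
Qed.
Next Obligation.
destruct (H _ H1) as [F1 [V1 [o1 [h1 s1]]]].
destruct (H0 _ H2) as [F2 [V2 [o2 [h2 s2]]]].
exists (F1 ++ F2), (fun i z => V1 i z /\ V2 i z).
split; [intros i; now apply open_inter|]; split; [intros i; now split|].
intros y Hy; split; [apply s1 | apply s2]; intros i Hi;
  apply (Hy i); apply in_or_app; auto.
Qed.
Next Obligation.
destruct (H _ H1 _ H2) as [F1 [V1 [o1 [h1 s1]]]].
exists F1, V1; repeat split; auto; intros y Hy; exists H0; split; auto.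
Qed.

Program Definition subspace_topology {T : Type} (tau : topology T)
  (P : T -> Prop) : topology {x : T | P x} :=
  Topology (fun W => exists U, open tau U /\
              forall z, W z <-> U (proj1_sig z)) _ _ _.
Next Obligation.
exists (fun _ => True); split; [apply open_full | tauto].
Qed.
Next Obligation.
exists (fun x => H x /\ H0 x); split; [now apply open_inter|].
intros z; rewrite H4, H2; tauto.
Qed.
Next Obligation.
exists (fun x => exists U, (open tau U /\
          exists W, F W /\ forall z, W z <-> U (proj1_sig z)) /\ U x).
split; [apply open_union; now intros U [HU _]|].
intros z; split.
- intros [W [FW Wz]]; destruct (H W FW) as [U [oU HU]].
  exists U; split; [split; [|exists W]|apply HU]; auto.
- intros [U [[oU [W [FW HW]]] Uz]]; exists W; split; [|apply HW]; auto.
Qed.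

Program Definition R_topology : topology R := Topology open_set _ _ _.
Next Obligation.
intros x _; exists (mkposreal 1 Rlt_0_1); now intros y _.
Qed.
Next Obligation.
intros x [Ux Vx]; destruct (H x Ux) as [d1 h1], (H0 x Vx) as [d2 h2].
assert (h : 0 < Rmin d1 d2) by (apply Rmin_pos; apply cond_pos).
exists (mkposreal _ h); unfold included, disc in *; simpl; intros y Hy; split.
- apply h1; apply Rlt_le_trans with (1 := Hy); apply Rmin_l.
- apply h2; apply Rlt_le_trans with (1 := Hy); apply Rmin_r.
Qed.
Next Obligation.
intros x [U [FU Ux]]; destruct (H U FU x Ux) as [d h].
exists d; intros y Hy; exists U; auto.
Qed.

(** * Category *)

Definition interior {T : Type} (tau : topology T) (A : T -> Prop) (x : T)
  : Prop :=
  exists U, open tau U /\ U x /\ forall y, U y -> A y.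

Definition closure {T : Type} (tau : topology T) (A : T -> Prop) (x : T)
  : Prop :=
  forall U, open tau U -> U x -> exists y, U y /\ A y.

Definition nowhere_dense {T : Type} (tau : topology T) (A : T -> Prop)
  : Prop :=
  forall x, ~ interior tau (closure tau A) x.

Definition meager {T : Type} (tau : topology T) (A : T -> Prop) : Prop :=
  exists N : nat -> T -> Prop,
    (forall n, nowhere_dense tau (N n)) /\ forall x, A x <-> exists n, N n x.

Definition symmetric_difference {T : Type} (A B : T -> Prop) (x : T) : Prop :=
  (A x /\ ~ B x) \/ (B x /\ ~ A x).

Definition baire_property {T : Type} (tau : topology T) (Y : T -> Prop)
  : Prop :=
  exists U, open tau U /\ meager tau (symmetric_difference Y U).

Definition cantor : Type := nat -> bool.

Definition cantor_topology : topology cantor :=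
  pi_topology (fun _ : nat => discrete_topology bool).

Definition all_cantor_baire : Prop :=
  forall Y : cantor -> Prop, baire_property cantor_topology Y.

Definition dependent_choice : Prop :=
  forall (X : Type) (Rel : X -> X -> Prop),
    inhabited X -> (forall x, exists y, Rel x y) ->
    exists z : nat -> X, forall n, Rel (z n) (z (S n)).

(** * Groups *)

Record group : Type := Group {
  carrier :> Type;
  gop : carrier -> carrier -> carrier;
  gone : carrier;
  ginv : carrier -> carrier;
  gop_assoc : forall a b c, gop a (gop b c) = gop (gop a b) c;
  gop_1_l : forall a, gop gone a = a;
  gop_1_r : forall a, gop a gone = a;
  gop_inv_l : forall a, gop (ginv a) a = gone;
  gop_inv_r : forall a, gop a (ginv a) = gone }.
Arguments gop {g}.
Arguments gone {g}.
Arguments ginv {g}.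

Record is_subgroup (G : group) (K : G -> Prop) : Prop := IsSubgroup {
  subgroup_1 : K gone;
  subgroup_op : forall a b, K a -> K b -> K (gop a b);
  subgroup_inv : forall a, K a -> K (ginv a) }.
Arguments subgroup_1 {G K}.
Arguments subgroup_op {G K}.
Arguments subgroup_inv {G K}.

Lemma sig_eq {T : Type} {P : T -> Prop} (a b : {x : T | P x}) :
  proj1_sig a = proj1_sig b -> a = b.
Proof.
destruct a as [a ha], b as [b hb]; simpl; intros <-.
now rewrite (proof_irrelevance _ ha hb).
Qed.

Program Definition subgroup (G : group) (K : G -> Prop)
  (HK : is_subgroup G K) : group :=
  Group {g : G | K g}
    (fun a b => exist K (gop (proj1_sig a) (proj1_sig b)) _)
    (exist K gone (subgroup_1 HK))
    (fun a => exist K (ginv (proj1_sig a)) _) _ _ _ _ _.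
Next Obligation. now apply (subgroup_op HK). Qed.
Next Obligation. now apply (subgroup_inv HK). Qed.
Next Obligation. apply sig_eq; apply gop_assoc. Qed.
Next Obligation. apply sig_eq; apply gop_1_l. Qed.
Next Obligation. apply sig_eq; apply gop_1_r. Qed.
Next Obligation. apply sig_eq; apply gop_inv_l. Qed.
Next Obligation. apply sig_eq; apply gop_inv_r. Qed.

Record length_function (G : group) (L : G -> R) : Prop := LengthFunction {
  length_ge0 : forall g, 0 <= L g;
  length_1 : L gone = 0;
  length_inv : forall g, L g = L (ginv g);
  length_op : forall g h, L (gop g h) <= L g + L h }.

Record topological_group (G : group) (tau : topology G) : Prop :=
  TopologicalGroup {
  gop_continuous : continuous (prod_topology tau tau) tau
                     (fun p => gop (fst p) (snd p));
  ginv_continuous : continuous tau tau ginv }.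

(* [partial_product g sigma n] is
   g_0^{sigma(0)} g_1^{sigma(1)} ... g_{n-1}^{sigma(n-1)}. *)
Fixpoint partial_product {G : group} (g : nat -> G) (sigma : cantor) (n : nat)
  : G :=
  match n with
  | O => gone
  | S m => gop (partial_product g sigma m) (if sigma m then g m else gone)
  end.

(* This is the relation g_n \searrow 1_G. *)
Definition searrow_1 (G : group) (tau : topology G) (g : nat -> G)
  : Prop :=
  forall sigma : cantor, exists y : G,
    converges tau (partial_product g sigma) y.

(** * Loops and the fundamental group *)

Definition unit_interval : Type := {t : R | 0 <= t <= 1}.

Definition I_topology : topology unit_interval :=
  subspace_topology R_topology (fun t => 0 <= t <= 1).

Lemma clamp_bounds (r : R) : 0 <= Rmax 0 (Rmin 1 r) <= 1.
Proof.
split; [apply Rmax_l | apply Rmax_lub; [lra | apply Rmin_l]].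
Qed.

(* The retraction of R onto [0,1]: below, it only serves to apply loops to
   real numbers that are known to lie in [0,1]. *)
Definition clamp (r : R) : unit_interval := exist _ _ (clamp_bounds r).

Record loop {X : Type} (tX : topology X) (x : X) : Type := Loop {
  loop_fun :> unit_interval -> X;
  loop_continuous : continuous I_topology tX loop_fun;
  loop_0 : loop_fun (clamp 0) = x;
  loop_1 : loop_fun (clamp 1) = x }.
Arguments Loop {X tX x}.
Arguments loop_fun {X tX x}.
Arguments loop_continuous {X tX x}.
Arguments loop_0 {X tX x}.
Arguments loop_1 {X tX x}.

Definition homotopic {X : Type} {tX : topology X} {x : X} (a b : loop tX x)
  : Prop :=
  exists H : unit_interval * unit_interval -> X,
    continuous (prod_topology I_topology I_topology) tX H /\
    (forall t, H (t, clamp 0) = a t) /\ (forall t, H (t, clamp 1) = b t) /\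
    (forall s, H (clamp 0, s) = x) /\ (forall s, H (clamp 1, s) = x).

Lemma clamp_val (r : R) : 0 <= r <= 1 -> proj1_sig (clamp r) = r.
Proof. intros H; simpl; unfold Rmax, Rmin; repeat destruct (Rle_dec _ _); lra. Qed.

Lemma clamp_proj (t : unit_interval) : clamp (proj1_sig t) = t.
Proof. apply sig_eq; apply clamp_val; exact (proj2_sig t). Qed.

Lemma clamp_le0 (r : R) : r <= 0 -> clamp r = clamp 0.
Proof.
intros H; apply sig_eq; simpl; unfold Rmax, Rmin.
repeat destruct (Rle_dec _ _); lra.
Qed.

Lemma clamp_ge1 (r : R) : 1 <= r -> clamp r = clamp 1.
Proof.
intros H; apply sig_eq; simpl; unfold Rmax, Rmin.
repeat destruct (Rle_dec _ _); lra.
Qed.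

Lemma continuous_comp {S T W : Type} (tS : topology S) (tT : topology T)
  (tW : topology W) (f : S -> T) (g : T -> W) :
  continuous tS tT f -> continuous tT tW g ->
  continuous tS tW (fun s => g (f s)).
Proof. intros Hf Hg U HU; exact (Hf _ (Hg U HU)). Qed.

Lemma continuous_id {S : Type} (tS : topology S) :
  continuous tS tS (fun s => s).
Proof. now intros U HU. Qed.

Lemma continuous_pair {S T W : Type} (tS : topology S) (tT : topology T)
  (tW : topology W) (f : W -> S) (g : W -> T) :
  continuous tW tS f -> continuous tW tT g ->
  continuous tW (prod_topology tS tT) (fun w => (f w, g w)).
Proof.
intros Hf Hg W' HW; apply open_local; intros w Hw.
destruct (HW _ Hw) as [U [V [oU [oV [Uw [Vw H]]]]]].
exists (fun w => U (f w) /\ V (g w)); split; [|split; [now split|]].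
- apply open_inter; [now apply Hf | now apply Hg].
- intros y [Uy Vy]; now apply H.
Qed.

Lemma continuous_fst {S T : Type} (tS : topology S) (tT : topology T) :
  continuous (prod_topology tS tT) tS fst.
Proof.
intros U HU p Hp; exists U, (fun _ => True).
repeat split; auto using open_full.
Qed.

Lemma continuous_snd {S T : Type} (tS : topology S) (tT : topology T) :
  continuous (prod_topology tS tT) tT snd.
Proof.
intros U HU p Hp; exists (fun _ => True), U.
repeat split; auto using open_full.
Qed.

Lemma continuous_proj : continuous I_topology R_topology (@proj1_sig _ _).
Proof. intros U HU; exists U; split; [exact HU | tauto]. Qed.

Lemma continuous_clamp {S : Type} (tS : topology S) (f : S -> R) :
  continuous tS R_topology f -> continuous tS I_topology (fun s => clamp (f s)).
Proof.
intros Hf W [U [oU HU]].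
assert (H : open R_topology (fun r => U (Rmax 0 (Rmin 1 r)))).
{ intros r Ur; destruct (oU _ Ur) as [d Hd]; exists d; intros q Hq.
  apply Hd; unfold disc in *; unfold Rabs, Rmax, Rmin in *.
  repeat destruct (Rle_dec _ _); repeat destruct (Rcase_abs _); lra. }
replace (fun s => W (clamp (f s))) with (fun s => U (Rmax 0 (Rmin 1 (f s)))).
- exact (Hf _ H).
- apply set_ext; intros s; rewrite HU; simpl; tauto.
Qed.

Lemma continuous_R_eps {S : Type} (tS : topology S) (f : S -> R) :
  continuous tS R_topology f <->
  forall s eps, 0 < eps -> exists U, open tS U /\ U s /\
    forall y, U y -> Rabs (f y - f s) < eps.
Proof.
split.
- intros Hf s eps He; exists (fun y => Rabs (f y - f s) < eps); repeat split.
  + apply (Hf (fun r => Rabs (r - f s) < eps)); intros r Hr.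
    assert (h : 0 < eps - Rabs (r - f s)) by lra.
    exists (mkposreal _ h); intros q; unfold disc; simpl; intros Hq.
    replace (q - f s) with ((q - r) + (r - f s)) by ring.
    pose proof (Rabs_triang (q - r) (r - f s)); lra.
  + now rewrite Rminus_diag, Rabs_R0.
  + auto.
- intros H U HU; apply open_local; intros s Us.
  destruct (HU _ Us) as [d Hd].
  destruct (H s d (cond_pos d)) as [V [oV [Vs HV]]].
  exists V; repeat split; auto; intros y Vy; apply Hd; now apply HV.
Qed.

Lemma continuous_R_const {S : Type} (tS : topology S) (c : R) :
  continuous tS R_topology (fun _ => c).
Proof.
apply continuous_R_eps; intros s eps He; exists (fun _ => True).
repeat split; [apply open_full|]; intros _ _; now rewrite Rminus_diag, Rabs_R0.
Qed.

Lemma continuous_Rplus {S : Type} (tS : topology S) (f g : S -> R) :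
  continuous tS R_topology f -> continuous tS R_topology g ->
  continuous tS R_topology (fun s => f s + g s).
Proof.
rewrite !continuous_R_eps; intros Hf Hg s eps He.
assert (He2 : 0 < eps / 2) by lra.
destruct (Hf s _ He2) as [U [oU [Us HU]]], (Hg s _ He2) as [V [oV [Vs HV]]].
exists (fun y => U y /\ V y).
split; [now apply open_inter|]; split; [now split|]; intros y [Uy Vy].
specialize (HU y Uy); specialize (HV y Vy).
replace (f y + g y - (f s + g s)) with ((f y - f s) + (g y - g s)) by ring.
pose proof (Rabs_triang (f y - f s) (g y - g s)); lra.
Qed.

Lemma continuous_Rmult {S : Type} (tS : topology S) (f g : S -> R) :
  continuous tS R_topology f -> continuous tS R_topology g ->
  continuous tS R_topology (fun s => f s * g s).
Proof.
rewrite !continuous_R_eps; intros Hf Hg s eps He.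
set (M := Rabs (f s) + Rabs (g s) + 1).
pose proof (Rabs_pos (f s)) as pf; pose proof (Rabs_pos (g s)) as pg.
assert (HM : 1 <= M) by (unfold M; lra).
set (d := Rmin 1 (eps / (2 * M))).
assert (Hd : 0 < d).
{ apply Rmin_pos; [lra|]; apply Rdiv_lt_0_compat; lra. }
assert (Hd1 : d <= 1) by apply Rmin_l.
assert (HdM : d * M <= eps / 2).
{ apply Rle_trans with (eps / (2 * M) * M).
  - apply Rmult_le_compat_r; [lra | apply Rmin_r].
  - right; field; lra. }
destruct (Hf s _ Hd) as [U [oU [Us HU]]], (Hg s _ Hd) as [V [oV [Vs HV]]].
exists (fun y => U y /\ V y).
split; [now apply open_inter|]; split; [now split|]; intros y [Uy Vy].
specialize (HU y Uy); specialize (HV y Vy).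
replace (f y * g y - f s * g s) with
  ((f y - f s) * (g y - g s) + ((f y - f s) * g s + f s * (g y - g s))) by ring.
pose proof (Rabs_triang ((f y - f s) * (g y - g s))
  ((f y - f s) * g s + f s * (g y - g s))).
pose proof (Rabs_triang ((f y - f s) * g s) (f s * (g y - g s))).
rewrite !Rabs_mult in *.
pose proof (Rabs_pos (f y - f s)); pose proof (Rabs_pos (g y - g s)).
unfold M in HdM; nra.
Qed.

Lemma continuous_Rmin {S : Type} (tS : topology S) (f g : S -> R) :
  continuous tS R_topology f -> continuous tS R_topology g ->
  continuous tS R_topology (fun s => Rmin (f s) (g s)).
Proof.
rewrite !continuous_R_eps; intros Hf Hg s eps He.
destruct (Hf s _ He) as [U [oU [Us HU]]], (Hg s _ He) as [V [oV [Vs HV]]].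
exists (fun y => U y /\ V y).
split; [now apply open_inter|]; split; [now split|]; intros y [Uy Vy].
specialize (HU y Uy); specialize (HV y Vy).
unfold Rmin, Rabs in *.
repeat destruct (Rle_dec _ _); repeat destruct (Rcase_abs _); lra.
Qed.

Lemma continuous_Rmax {S : Type} (tS : topology S) (f g : S -> R) :
  continuous tS R_topology f -> continuous tS R_topology g ->
  continuous tS R_topology (fun s => Rmax (f s) (g s)).
Proof.
rewrite !continuous_R_eps; intros Hf Hg s eps He.
destruct (Hf s _ He) as [U [oU [Us HU]]], (Hg s _ He) as [V [oV [Vs HV]]].
exists (fun y => U y /\ V y).
split; [now apply open_inter|]; split; [now split|]; intros y [Uy Vy].
specialize (HU y Uy); specialize (HV y Vy).
unfold Rmax, Rabs in *.
repeat destruct (Rle_dec _ _); repeat destruct (Rcase_abs _); lra.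
Qed.

Lemma open_lt_l {S : Type} (tS : topology S) (f : S -> R) (c : R) :
  continuous tS R_topology f -> open tS (fun s => f s < c).
Proof.
rewrite continuous_R_eps; intros Hf; apply open_local; intros s Hs.
destruct (Hf s (c - f s)) as [U [oU [Us HU]]]; [lra|].
exists U; repeat split; auto; intros y Uy; specialize (HU y Uy).
unfold Rabs in HU; destruct (Rcase_abs _); lra.
Qed.

Lemma open_lt_r {S : Type} (tS : topology S) (f : S -> R) (c : R) :
  continuous tS R_topology f -> open tS (fun s => c < f s).
Proof.
rewrite continuous_R_eps; intros Hf; apply open_local; intros s Hs.
destruct (Hf s (f s - c)) as [U [oU [Us HU]]]; [lra|].
exists U; repeat split; auto; intros y Uy; specialize (HU y Uy).
unfold Rabs in HU; destruct (Rcase_abs _); lra.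
Qed.

Lemma continuous_paste {S T : Type} (tS : topology S) (tT : topology T)
  (h : S -> R) (c : R) (f g : S -> T) :
  continuous tS R_topology h -> continuous tS tT f -> continuous tS tT g ->
  (forall s, h s = c -> f s = g s) ->
  continuous tS tT (fun s => if Rle_dec (h s) c then f s else g s).
Proof.
intros Hh Hf Hg E U HU; apply open_local; intros s Hs.
destruct (Rtotal_order (h s) c) as [lt | [eq | gt]].
- exists (fun y => h y < c /\ U (f y)); repeat split; auto.
  + apply open_inter; [now apply open_lt_l | now apply Hf].
  + destruct (Rle_dec (h s) c); [auto | lra].
  + intros y [hy Uy]; destruct (Rle_dec (h y) c); [auto | lra].
- exists (fun y => U (f y) /\ U (g y)); repeat split; auto.
  + apply open_inter; [now apply Hf | now apply Hg].
  + destruct (Rle_dec (h s) c); [auto | lra].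
  + rewrite <- E by auto; destruct (Rle_dec (h s) c); [auto | lra].
  + intros y [Uf Ug]; destruct (Rle_dec (h y) c); auto.
- exists (fun y => c < h y /\ U (g y)); repeat split; auto.
  + apply open_inter; [now apply open_lt_r | now apply Hg].
  + destruct (Rle_dec (h s) c); [lra | auto].
  + intros y [hy Uy]; destruct (Rle_dec (h y) c); [lra | auto].
Qed.

Create HintDb cont.
#[export] Hint Resolve continuous_R_const continuous_Rplus continuous_Rmult
  continuous_Rmin continuous_Rmax continuous_proj continuous_clamp
  continuous_fst continuous_snd continuous_id : cont.

Lemma continuous_Ropp {S : Type} (tS : topology S) (f : S -> R) :
  continuous tS R_topology f -> continuous tS R_topology (fun s => - f s).
Proof.
intros Hf; replace (fun s => - f s) with (fun s => (-1) * f s);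
  [auto with cont | apply functional_extensionality; intros; ring].
Qed.

Lemma continuous_Rminus {S : Type} (tS : topology S) (f g : S -> R) :
  continuous tS R_topology f -> continuous tS R_topology g ->
  continuous tS R_topology (fun s => f s - g s).
Proof.
intros; unfold Rminus; apply continuous_Rplus; auto using continuous_Ropp.
Qed.

Lemma continuous_proj_fst : continuous (prod_topology I_topology I_topology)
  R_topology (fun p => proj1_sig (fst p)).
Proof. exact (continuous_comp _ _ _ _ _ (continuous_fst _ _) continuous_proj). Qed.

Lemma continuous_proj_snd : continuous (prod_topology I_topology I_topology)
  R_topology (fun p => proj1_sig (snd p)).
Proof. exact (continuous_comp _ _ _ _ _ (continuous_snd _ _) continuous_proj). Qed.

#[export] Hint Resolve continuous_Ropp continuous_Rminus continuous_proj_fst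
  continuous_proj_snd : cont.

Lemma loop_le0 {X : Type} {tX : topology X} {x : X} (l : loop tX x) (r : R) :
  r <= 0 -> l (clamp r) = x.
Proof. intros H; rewrite clamp_le0 by auto; apply loop_0. Qed.

Lemma loop_ge1 {X : Type} {tX : topology X} {x : X} (l : loop tX x) (r : R) :
  1 <= r -> l (clamp r) = x.
Proof. intros H; rewrite clamp_ge1 by auto; apply loop_1. Qed.

Lemma loop_comp_continuous {X S : Type} {tX : topology X} {x : X}
  (tS : topology S) (l : loop tX x) (f : S -> R) :
  continuous tS R_topology f -> continuous tS tX (fun s => l (clamp (f s))).
Proof.
intros Hf; apply (continuous_comp tS I_topology tX (fun s => clamp (f s))).
- auto with cont.
- apply loop_continuous.
Qed.

Program Definition const_loop {X : Type} (tX : topology X) (x : X)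
  : loop tX x := Loop (fun _ => x) _ eq_refl eq_refl.
Next Obligation.
intros U HU; apply open_local; intros s Us; exists (fun _ => True).
repeat split; auto using open_full.
Qed.

Program Definition concat {X : Type} {tX : topology X} {x : X}
  (a b : loop tX x) : loop tX x :=
  Loop (fun t => if Rle_dec (proj1_sig t) (1 / 2)
                 then a (clamp (2 * proj1_sig t))
                 else b (clamp (2 * proj1_sig t - 1))) _ _ _.
Next Obligation.
apply continuous_paste; auto using loop_comp_continuous with cont.
intros s E; rewrite loop_ge1 by lra; rewrite loop_le0 by lra; reflexivity.
Qed.
Next Obligation.
change (Rmax 0 (Rmin 1 0)) with (proj1_sig (clamp 0)); rewrite clamp_val by lra.
destruct (Rle_dec _ _); [apply loop_le0 | ]; lra.
Qed.
Next Obligation.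
change (Rmax 0 (Rmin 1 1)) with (proj1_sig (clamp 1)); rewrite clamp_val by lra.
destruct (Rle_dec _ _); [ | apply loop_ge1]; lra.
Qed.

Program Definition reverse {X : Type} {tX : topology X} {x : X}
  (a : loop tX x) : loop tX x :=
  Loop (fun t => a (clamp (1 - proj1_sig t))) _ _ _.
Next Obligation. auto using loop_comp_continuous with cont. Qed.
Next Obligation.
change (Rmax 0 (Rmin 1 0)) with (proj1_sig (clamp 0)); rewrite clamp_val by lra; apply loop_ge1; lra.
Qed.
Next Obligation.
change (Rmax 0 (Rmin 1 1)) with (proj1_sig (clamp 1)); rewrite clamp_val by lra; apply loop_le0; lra.
Qed.

Lemma homotopic_reparam {X : Type} {tX : topology X} {x : X}
  (l a b : loop tX x) (phi psi : unit_interval -> R) :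
  continuous I_topology R_topology phi ->
  continuous I_topology R_topology psi ->
  phi (clamp 0) = psi (clamp 0) -> phi (clamp 1) = psi (clamp 1) ->
  (forall t, a t = l (clamp (phi t))) -> (forall t, b t = l (clamp (psi t))) ->
  homotopic a b.
Proof.
intros Hphi Hpsi E0 E1 Ha Hb.
exists (fun p => l (clamp ((1 - proj1_sig (snd p)) * phi (fst p) +
                           proj1_sig (snd p) * psi (fst p)))).
repeat split.
- apply loop_comp_continuous.
  assert (continuous (prod_topology I_topology I_topology) R_topology
            (fun p => phi (fst p))) by
    exact (continuous_comp _ _ _ _ _ (continuous_fst _ _) Hphi).
  assert (continuous (prod_topology I_topology I_topology) R_topology
            (fun p => psi (fst p))) by
    exact (continuous_comp _ _ _ _ _ (continuous_fst _ _) Hpsi).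
  auto 10 with cont.
- intros t; cbn [fst snd]; rewrite clamp_val by lra; rewrite Ha.
  do 2 f_equal; ring.
- intros t; cbn [fst snd]; rewrite clamp_val by lra; rewrite Hb.
  do 2 f_equal; ring.
- intros s; cbn [fst snd]; rewrite <- E0, <- (loop_0 a), Ha.
  do 2 f_equal; ring.
- intros s; cbn [fst snd]; rewrite <- E1, <- (loop_1 a), Ha.
  do 2 f_equal; ring.
Qed.

Lemma homotopic_refl {X : Type} {tX : topology X} {x : X} (a : loop tX x) :
  homotopic a a.
Proof.
apply (homotopic_reparam a a a (@proj1_sig _ _) (@proj1_sig _ _));
  auto with cont; intros t; now rewrite clamp_proj.
Qed.

Lemma homotopic_sym {X : Type} {tX : topology X} {x : X} (a b : loop tX x) :
  homotopic a b -> homotopic b a.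
Proof.
intros [H [cH [H0 [H1 [Hl Hr]]]]].
exists (fun p => H (fst p, clamp (1 - proj1_sig (snd p)))); repeat split.
- apply (continuous_comp _ (prod_topology I_topology I_topology) _
    (fun p => (fst p, clamp (1 - proj1_sig (snd p))))); [|exact cH].
  apply continuous_pair; auto with cont.
- intros t; cbn [fst snd]; rewrite clamp_val, clamp_ge1 by lra; apply H1.
- intros t; cbn [fst snd]; rewrite clamp_val, clamp_le0 by lra; apply H0.
- intros s; apply Hl.
- intros s; apply Hr.
Qed.

Lemma homotopic_trans {X : Type} {tX : topology X} {x : X}
  (a b c : loop tX x) : homotopic a b -> homotopic b c -> homotopic a c.
Proof.
intros [H [cH [H0 [H1 [Hl Hr]]]]] [H' [cH' [H0' [H1' [Hl' Hr']]]]].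
exists (fun p => if Rle_dec (proj1_sig (snd p)) (1 / 2)
                 then H (fst p, clamp (2 * proj1_sig (snd p)))
                 else H' (fst p, clamp (2 * proj1_sig (snd p) - 1))).
repeat split.
- apply continuous_paste; auto with cont.
  + apply (continuous_comp _ (prod_topology I_topology I_topology) _
      (fun p => (fst p, clamp (2 * proj1_sig (snd p))))); [|exact cH].
    apply continuous_pair; auto with cont.
  + apply (continuous_comp _ (prod_topology I_topology I_topology) _
      (fun p => (fst p, clamp (2 * proj1_sig (snd p) - 1)))); [|exact cH'].
    apply continuous_pair; auto with cont.
  + intros [t s] E; cbn [fst snd] in *.
    rewrite (clamp_ge1 (2 * proj1_sig s)), (clamp_le0 (2 * proj1_sig s - 1))
      by lra; now rewrite H1, H0'.
- intros t; cbn [fst snd]; rewrite clamp_val by lra.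
  destruct (Rle_dec _ _); [|lra]; rewrite clamp_le0 by lra; apply H0.
- intros t; cbn [fst snd]; rewrite clamp_val by lra.
  destruct (Rle_dec _ _); [lra|]; rewrite clamp_ge1 by lra; apply H1'.
- intros s; cbn [fst snd]; destruct (Rle_dec _ _); auto.
- intros s; cbn [fst snd]; destruct (Rle_dec _ _); auto.
Qed.

Lemma homotopic_concat {X : Type} {tX : topology X} {x : X}
  (a a' b b' : loop tX x) :
  homotopic a a' -> homotopic b b' -> homotopic (concat a b) (concat a' b').
Proof.
intros [H [cH [H0 [H1 [Hl Hr]]]]] [H' [cH' [H0' [H1' [Hl' Hr']]]]].
exists (fun p => if Rle_dec (proj1_sig (fst p)) (1 / 2)
                 then H (clamp (2 * proj1_sig (fst p)), snd p)
                 else H' (clamp (2 * proj1_sig (fst p) - 1), snd p)).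
repeat split.
- apply continuous_paste; auto with cont.
  + apply (continuous_comp _ (prod_topology I_topology I_topology) _
      (fun p => (clamp (2 * proj1_sig (fst p)), snd p))); [|exact cH].
    apply continuous_pair; auto with cont.
  + apply (continuous_comp _ (prod_topology I_topology I_topology) _
      (fun p => (clamp (2 * proj1_sig (fst p) - 1), snd p))); [|exact cH'].
    apply continuous_pair; auto with cont.
  + intros [t s] E; cbn [fst snd] in *.
    rewrite (clamp_ge1 (2 * proj1_sig t)), (clamp_le0 (2 * proj1_sig t - 1))
      by lra; now rewrite Hr, Hl'.
- intros t; cbn [fst snd concat loop_fun]; destruct (Rle_dec _ _); auto.
- intros t; cbn [fst snd concat loop_fun]; destruct (Rle_dec _ _); auto.
- intros s; cbn [fst snd]; rewrite clamp_val by lra.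
  destruct (Rle_dec _ _); [|lra]; rewrite clamp_le0 by lra; apply Hl.
- intros s; cbn [fst snd]; rewrite clamp_val by lra.
  destruct (Rle_dec _ _); [lra|]; rewrite clamp_ge1 by lra; apply Hr'.
Qed.

Lemma homotopic_reverse {X : Type} {tX : topology X} {x : X}
  (a b : loop tX x) : homotopic a b -> homotopic (reverse a) (reverse b).
Proof.
intros [H [cH [H0 [H1 [Hl Hr]]]]].
exists (fun p => H (clamp (1 - proj1_sig (fst p)), snd p)); repeat split.
- apply (continuous_comp _ (prod_topology I_topology I_topology) _
    (fun p => (clamp (1 - proj1_sig (fst p)), snd p))); [|exact cH].
  apply continuous_pair; auto with cont.
- intros t; apply H0.
- intros t; apply H1.
- intros s; cbn [fst snd]; rewrite clamp_val, clamp_ge1 by lra; apply Hr.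
- intros s; cbn [fst snd]; rewrite clamp_val, clamp_le0 by lra; apply Hl.
Qed.

Lemma concat_assoc {X : Type} {tX : topology X} {x : X} (a b c : loop tX x) :
  homotopic (concat a (concat b c)) (concat (concat a b) c).
Proof.
apply (homotopic_reparam (concat a (concat b c)) _ _ (@proj1_sig _ _)
  (fun t => Rmin (2 * proj1_sig t)
              (Rmin (proj1_sig t + 1 / 4) (1 / 2 * proj1_sig t + 1 / 2))));
  auto 10 with cont.
- rewrite clamp_val by lra; unfold Rmin; repeat destruct (Rle_dec _ _); lra.
- rewrite clamp_val by lra; unfold Rmin; repeat destruct (Rle_dec _ _); lra.
- intros t; now rewrite clamp_proj.
- intros [t Ht]; cbn [concat loop_fun proj1_sig].
  set (m := Rmin (2 * t) _).
  assert (Hm : m = if Rle_dec t (1 / 4) then 2 * t else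
               if Rle_dec t (1 / 2) then t + 1 / 4 else 1 / 2 * t + 1 / 2)
    by (unfold m, Rmin; repeat destruct (Rle_dec _ _); lra).
  assert (Bm : 0 <= m <= 1)
    by (rewrite Hm; repeat destruct (Rle_dec _ _); lra).
  rewrite (clamp_val m Bm); clearbody m; subst m.
  destruct (Rle_dec t (1 / 2)), (Rle_dec t (1 / 4)); try lra.
  + rewrite clamp_val by lra; repeat destruct (Rle_dec _ _); try lra.
    reflexivity.
  + rewrite !clamp_val by lra; repeat destruct (Rle_dec _ _); try lra;
      do 2 f_equal; lra.
  + rewrite !clamp_val by lra; repeat destruct (Rle_dec _ _); try lra;
      do 2 f_equal; lra.
Qed.

Lemma concat_const_l {X : Type} {tX : topology X} {x : X} (a : loop tX x) :
  homotopic (concat (const_loop tX x) a) a.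
Proof.
apply (homotopic_reparam a _ _ (fun t => Rmax 0 (2 * proj1_sig t - 1))
  (@proj1_sig _ _)); auto 10 with cont.
- rewrite clamp_val by lra; unfold Rmax; repeat destruct (Rle_dec _ _); lra.
- rewrite clamp_val by lra; unfold Rmax; repeat destruct (Rle_dec _ _); lra.
- intros [t Ht]; cbn [concat loop_fun proj1_sig const_loop].
  unfold Rmax; repeat destruct (Rle_dec _ _); try lra; auto.
  + rewrite loop_le0 by lra; reflexivity.
  + rewrite loop_0; reflexivity.
- intros t; now rewrite clamp_proj.
Qed.

Lemma concat_const_r {X : Type} {tX : topology X} {x : X} (a : loop tX x) :
  homotopic (concat a (const_loop tX x)) a.
Proof.
apply (homotopic_reparam a _ _ (fun t => Rmin 1 (2 * proj1_sig t))
  (@proj1_sig _ _)); auto 10 with cont.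
- rewrite clamp_val by lra; unfold Rmin; repeat destruct (Rle_dec _ _); lra.
- rewrite clamp_val by lra; unfold Rmin; repeat destruct (Rle_dec _ _); lra.
- intros [t Ht]; cbn [concat loop_fun proj1_sig const_loop].
  unfold Rmin; repeat destruct (Rle_dec _ _); try lra; auto.
  + rewrite loop_1, loop_ge1 by lra; reflexivity.
  + rewrite loop_1; reflexivity.
- intros t; now rewrite clamp_proj.
Qed.

Lemma concat_reverse_r {X : Type} {tX : topology X} {x : X} (a : loop tX x) :
  homotopic (concat a (reverse a)) (const_loop tX x).
Proof.
apply (homotopic_reparam a _ _
  (fun t => Rmin (2 * proj1_sig t) (2 - 2 * proj1_sig t)) (fun _ => 0));
  auto 10 with cont.
- rewrite clamp_val by lra; unfold Rmin; repeat destruct (Rle_dec _ _); lra.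
- rewrite clamp_val by lra; unfold Rmin; repeat destruct (Rle_dec _ _); lra.
- intros [t Ht]; cbn [concat loop_fun proj1_sig reverse].
  destruct (Rle_dec t (1 / 2)).
  + rewrite Rmin_left by lra; reflexivity.
  + rewrite Rmin_right by lra; rewrite clamp_val by lra; do 2 f_equal; ring.
- intros t; symmetry; apply loop_0.
Qed.

Lemma concat_reverse_l {X : Type} {tX : topology X} {x : X} (a : loop tX x) :
  homotopic (concat (reverse a) a) (const_loop tX x).
Proof.
apply (homotopic_reparam a _ _
  (fun t => Rmax (1 - 2 * proj1_sig t) (2 * proj1_sig t - 1)) (fun _ => 1));
  auto 10 with cont.
- rewrite clamp_val by lra; unfold Rmax; repeat destruct (Rle_dec _ _); lra.
- rewrite clamp_val by lra; unfold Rmax; repeat destruct (Rle_dec _ _); lra.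
- intros [t Ht]; cbn [concat loop_fun proj1_sig reverse].
  destruct (Rle_dec t (1 / 2)).
  + rewrite Rmax_left by lra; rewrite clamp_val by lra; do 2 f_equal; ring.
  + rewrite Rmax_right by lra; reflexivity.
- intros t; symmetry; apply loop_1.
Qed.

(* The set of homotopy classes of loops at x, a class being a set of loops. *)
Definition pi1_carrier {X : Type} (tX : topology X) (x : X) : Type :=
  {c : loop tX x -> Prop | exists l, c = homotopic l}.

Definition loop_class {X : Type} {tX : topology X} {x : X} (l : loop tX x)
  : pi1_carrier tX x :=
  exist _ (homotopic l) (ex_intro _ l eq_refl).

Lemma loop_class_eq {X : Type} {tX : topology X} {x : X} (a b : loop tX x) :
  loop_class a = loop_class b <-> homotopic a b.
Proof.
split.
- intros E; apply (f_equal (fun c => proj1_sig c b)) in E; simpl in E.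
  rewrite E; apply homotopic_refl.
- intros H; apply sig_eq, set_ext; intros l; simpl; split; intros Hl.
  + apply homotopic_trans with a; auto using homotopic_sym.
  + now apply homotopic_trans with b.
Qed.

Lemma pi1_ind {X : Type} {tX : topology X} {x : X} (c : pi1_carrier tX x) :
  exists l, c = loop_class l.
Proof.
destruct c as [c [l E]]; exists l; apply sig_eq; exact E.
Qed.

Program Definition pi1_op {X : Type} {tX : topology X} {x : X}
  (c d : pi1_carrier tX x) : pi1_carrier tX x :=
  exist _ (fun l => exists a b, proj1_sig c a /\ proj1_sig d b /\
                                homotopic (concat a b) l) _.
Next Obligation.
destruct (pi1_ind c) as [a ->], (pi1_ind d) as [b ->].
exists (concat a b); apply set_ext; intros l; simpl; split.
- intros [a' [b' [Ha [Hb Hl]]]].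
  apply homotopic_trans with (concat a' b'); auto using homotopic_concat.
- intros Hl; exists a, b; auto using homotopic_refl.
Qed.

Program Definition pi1_inv {X : Type} {tX : topology X} {x : X}
  (c : pi1_carrier tX x) : pi1_carrier tX x :=
  exist _ (fun l => exists a, proj1_sig c a /\ homotopic (reverse a) l) _.
Next Obligation.
destruct (pi1_ind c) as [a ->].
exists (reverse a); apply set_ext; intros l; simpl; split.
- intros [a' [Ha Hl]].
  apply homotopic_trans with (reverse a'); auto using homotopic_reverse.
- intros Hl; exists a; auto using homotopic_refl.
Qed.

Lemma pi1_op_class {X : Type} {tX : topology X} {x : X} (a b : loop tX x) :
  pi1_op (loop_class a) (loop_class b) = loop_class (concat a b).
Proof.
apply sig_eq, set_ext; intros l; simpl; split.
- intros [a' [b' [Ha [Hb Hl]]]].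
  apply homotopic_trans with (concat a' b'); auto using homotopic_concat.
- intros Hl; exists a, b; auto using homotopic_refl.
Qed.

Lemma pi1_inv_class {X : Type} {tX : topology X} {x : X} (a : loop tX x) :
  pi1_inv (loop_class a) = loop_class (reverse a).
Proof.
apply sig_eq, set_ext; intros l; simpl; split.
- intros [a' [Ha Hl]].
  apply homotopic_trans with (reverse a'); auto using homotopic_reverse.
- intros Hl; exists a; auto using homotopic_refl.
Qed.

Program Definition pi1 {X : Type} (tX : topology X) (x : X) : group :=
  Group (pi1_carrier tX x) pi1_op (loop_class (const_loop tX x)) pi1_inv
    _ _ _ _ _.
Next Obligation.
destruct (pi1_ind a) as [a' ->], (pi1_ind b) as [b' ->], (pi1_ind c) as [c' ->].
rewrite !pi1_op_class; apply loop_class_eq, concat_assoc.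
Qed.
Next Obligation.
destruct (pi1_ind a) as [a' ->].
rewrite pi1_op_class; apply loop_class_eq, concat_const_l.
Qed.
Next Obligation.
destruct (pi1_ind a) as [a' ->].
rewrite pi1_op_class; apply loop_class_eq, concat_const_r.
Qed.
Next Obligation.
destruct (pi1_ind a) as [a' ->].
rewrite pi1_inv_class, pi1_op_class; apply loop_class_eq, concat_reverse_l.
Qed.
Next Obligation.
destruct (pi1_ind a) as [a' ->].
rewrite pi1_inv_class, pi1_op_class; apply loop_class_eq, concat_reverse_r.
Qed.

(** * Infinite concatenations *)

(* This is the relation l_n \searrow x. *)
Definition loops_shrink {X : Type} {tX : topology X} {x : X}
  (l : nat -> loop tX x) : Prop :=
  forall U, open tX U -> U x ->
    exists N, forall n, (N <= n)%nat -> forall t, U (l n t).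

Definition loop_pow {X : Type} {tX : topology X} {x : X} (l : loop tX x)
  (e : bool) : loop tX x :=
  if e then l else const_loop tX x.

Lemma lt1_ex (t : R) : t < 1 -> exists n, t <= 1 - 1 / 2 ^ (S n).
Proof.
intros Ht.
destruct (pow_lt_1_zero (/ 2)) with (y := 1 - t) as [N HN];
  [rewrite Rabs_pos_eq; lra | lra |].
exists N; specialize (HN (S N) ltac:(lia)).
rewrite pow_inv, Rabs_pos_eq in HN; [unfold Rdiv; lra|].
left; apply Rinv_0_lt_compat, pow_lt; lra.
Qed.

(* For t < 1, the least n with t <= 1 - 1/2^(n+1); the search is effective,
   so that no choice is involved.  A breakpoint t = 1 - 1/2^(n+1) belongs to
   two of the intervals [1 - 1/2^n, 1 - 1/2^(n+1)] and is attributed to the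
   first one, which is harmless: see [omega_concat_spec]. *)
Definition piece (t : R) (Ht : t < 1) : nat :=
  proj1_sig (epsilon_smallest (fun n => t <= 1 - 1 / 2 ^ (S n))
               (fun n => Rle_dec t (1 - 1 / 2 ^ (S n))) (lt1_ex t Ht)).

Definition omega_concat_fun {X : Type} {tX : topology X} {x : X}
  (l : nat -> loop tX x) (sigma : cantor) (t : unit_interval) : X :=
  match Rlt_dec (proj1_sig t) 1 with
  | left Ht =>
      let n := piece (proj1_sig t) Ht in
      loop_pow (l n) (sigma n) (clamp (2 ^ (S n) * (proj1_sig t - 1) + 2))
  | right _ => x
  end.

Lemma brk_lt (m n : nat) : (m < n)%nat -> 1 - 1 / 2 ^ m < 1 - 1 / 2 ^ n.
Proof.
intros H.
assert (0 < 2 ^ m) by (apply pow_lt; lra).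
assert (2 ^ m < 2 ^ n) by (apply Rlt_pow; [lra | lia]).
assert (/ 2 ^ n < / 2 ^ m) by (apply Rinv_lt_contravar; nra).
unfold Rdiv; lra.
Qed.

Lemma brk_le (m n : nat) : (m <= n)%nat -> 1 - 1 / 2 ^ m <= 1 - 1 / 2 ^ n.
Proof.
intros H; destruct (Nat.eq_dec m n) as [->|]; [lra|].
left; apply brk_lt; lia.
Qed.

Lemma brk_lt1 (n : nat) : 1 - 1 / 2 ^ n < 1.
Proof.
assert (0 < / 2 ^ n) by (apply Rinv_0_lt_compat, pow_lt; lra).
unfold Rdiv; lra.
Qed.

Lemma piece_param_hi (n : nat) (t : R) : t = 1 - 1 / 2 ^ (S n) ->
  2 ^ (S n) * (t - 1) + 2 = 1.
Proof. intros ->; field; apply pow_nonzero; lra. Qed.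

Lemma piece_param_lo (n : nat) (t : R) : t = 1 - 1 / 2 ^ n ->
  2 ^ (S n) * (t - 1) + 2 = 0.
Proof. intros ->; simpl; field; apply pow_nonzero; lra. Qed.

Lemma piece_spec (t : R) (Ht : t < 1) : 0 <= t ->
  1 - 1 / 2 ^ (piece t Ht) <= t <= 1 - 1 / 2 ^ (S (piece t Ht)) /\
  (piece t Ht = O \/ 1 - 1 / 2 ^ (piece t Ht) < t).
Proof.
intros H0; unfold piece.
destruct (epsilon_smallest _ _ _) as [n [Hn Hmin]]; cbn [proj1_sig].
destruct n as [|n].
- split; [split; [|exact Hn] | now left]; simpl; lra.
- assert (1 - 1 / 2 ^ S n < t).
  { apply Rnot_le_lt; intros C; specialize (Hmin n C); lia. }
  split; [split; [lra | exact Hn] | now right].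
Qed.

(* The defining equation of the infinite concatenation, at every point of
   each closed interval. *)
Lemma omega_concat_spec {X : Type} {tX : topology X} {x : X}
  (l : nat -> loop tX x) (sigma : cantor) (n : nat) (t : unit_interval) :
  1 - 1 / 2 ^ n <= proj1_sig t <= 1 - 1 / 2 ^ (S n) ->
  omega_concat_fun l sigma t =
  loop_pow (l n) (sigma n) (clamp (2 ^ (S n) * (proj1_sig t - 1) + 2)).
Proof.
intros Hn; unfold omega_concat_fun.
destruct (Rlt_dec (proj1_sig t) 1) as [Ht | C];
  [|pose proof (brk_lt1 (S n)); lra].
cbv zeta.
destruct (piece_spec (proj1_sig t) Ht) as [Hm Hm'];
  [exact (proj1 (proj2_sig t))|].
set (m := piece (proj1_sig t) Ht) in *; clearbody m.
destruct (Nat.lt_trichotomy m n) as [lt | [-> | gt]]; [| reflexivity |].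
- pose proof (brk_le (S m) n lt).
  rewrite (piece_param_hi m) by lra; rewrite (piece_param_lo n) by lra.
  now rewrite loop_1, loop_0.
- exfalso; pose proof (brk_le (S n) m gt); destruct Hm' as [-> | ?]; [lia|lra].
Qed.

Lemma omega_concat_1 {X : Type} {tX : topology X} {x : X}
  (l : nat -> loop tX x) (sigma : cantor) :
  omega_concat_fun l sigma (clamp 1) = x.
Proof.
unfold omega_concat_fun; destruct (Rlt_dec _ _) as [H|]; auto.
exfalso; rewrite clamp_val in H; lra.
Qed.

Lemma loop_pow_in {X : Type} {tX : topology X} {x : X} (l : loop tX x)
  (e : bool) (U : X -> Prop) (t : unit_interval) :
  U x -> (forall t, U (l t)) -> U (loop_pow l e t).
Proof. destruct e; simpl; auto. Qed.

Lemma omega_concat_continuous {X : Type} {tX : topology X} {x : X}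
  (l : nat -> loop tX x) (Hl : loops_shrink l) (sigma : cantor) :
  continuous I_topology tX (omega_concat_fun l sigma).
Proof.
intros U HU; apply open_local; intros t Ut.
destruct (Rlt_dec (proj1_sig t) 1) as [Ht | Ht].
- destruct (piece_spec (proj1_sig t) Ht) as [Hn Hn'];
    [exact (proj1 (proj2_sig t))|].
  set (n := piece (proj1_sig t) Ht) in *; clearbody n.
  set (g := fun m (s : unit_interval) =>
    loop_pow (l m) (sigma m) (clamp (2 ^ (S m) * (proj1_sig s - 1) + 2))).
  assert (Hg : forall m, continuous I_topology tX (g m)).
  { intros m; apply loop_comp_continuous; auto 10 with cont. }
  set (lo := match n with O => -1 | _ => 1 - 1 / 2 ^ n end).
  assert (Hlo : forall s : unit_interval,
             lo < proj1_sig s -> 1 - 1 / 2 ^ n <= proj1_sig s).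
  { intros s Hs; unfold lo in Hs; destruct n; [|lra].
    simpl; pose proof (proj2_sig s) as B; simpl in B; lra. }
  assert (Hlot : lo < proj1_sig t).
  { unfold lo; destruct n; [pose proof (proj2_sig t) as B; simpl in B; lra|].
    destruct Hn' as [C | ?]; [discriminate | auto]. }
  pose proof (brk_lt (S n) (S (S n)) ltac:(lia)) as Hb.
  assert (Gt : omega_concat_fun l sigma t = g n t)
    by (apply omega_concat_spec; auto).
  destruct (Rlt_dec (proj1_sig t) (1 - 1 / 2 ^ S n)) as [lt | ge].
  + exists (fun s => (lo < proj1_sig s /\ proj1_sig s < 1 - 1 / 2 ^ S n) /\
                     U (g n s)); repeat split; auto.
    * apply open_inter; [apply open_inter|now apply Hg];
        [apply open_lt_r | apply open_lt_l]; auto with cont.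
    * now rewrite <- Gt.
    * intros s [[s1 s2] Us]; rewrite (omega_concat_spec l sigma n); auto.
      split; [auto | lra].
  + assert (Et : proj1_sig t = 1 - 1 / 2 ^ S n) by lra.
    exists (fun s => (lo < proj1_sig s /\ proj1_sig s < 1 - 1 / 2 ^ S (S n)) /\
                     (U (g n s) /\ U (g (S n) s))); repeat split; auto.
    * apply open_inter; apply open_inter;
        [apply open_lt_r | apply open_lt_l | apply Hg | apply Hg];
        auto with cont.
    * lra.
    * now rewrite <- Gt.
    * rewrite (omega_concat_spec l sigma (S n)) in Ut; [exact Ut | lra].
    * intros s [[s1 s2] [Un USn]].
      destruct (Rle_dec (proj1_sig s) (1 - 1 / 2 ^ S n)).
      -- rewrite (omega_concat_spec l sigma n); auto.
      -- rewrite (omega_concat_spec l sigma (S n)); auto; lra.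
- assert (Ux : U x).
  { unfold omega_concat_fun in Ut.
    destruct (Rlt_dec (proj1_sig t) 1); [contradiction | auto]. }
  destruct (Hl U HU Ux) as [N HN].
  exists (fun s => 1 - 1 / 2 ^ N < proj1_sig s); repeat split.
  + apply open_lt_r; auto with cont.
  + pose proof (brk_lt1 N); lra.
  + intros s Hs; unfold omega_concat_fun.
    destruct (Rlt_dec (proj1_sig s) 1) as [h|]; [|auto].
    destruct (piece_spec (proj1_sig s) h) as [Hm _];
      [exact (proj1 (proj2_sig s))|].
    cbv zeta; set (m := piece (proj1_sig s) h) in *; clearbody m.
    apply loop_pow_in; auto; apply HN.
    destruct (Nat.le_gt_cases N m) as [|lt]; auto.
    exfalso; pose proof (brk_le (S m) N lt); lra.
Qed.

Lemma omega_concat_0 {X : Type} {tX : topology X} {x : X}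
  (l : nat -> loop tX x) (sigma : cantor) :
  omega_concat_fun l sigma (clamp 0) = x.
Proof.
rewrite (omega_concat_spec l sigma 0); rewrite clamp_val; try (simpl; lra).
apply loop_le0; simpl; lra.
Qed.

(* The loop l^sigma. *)
Definition omega_concat {X : Type} {tX : topology X} {x : X}
  (l : nat -> loop tX x) (Hl : loops_shrink l) (sigma : cantor) : loop tX x :=
  Loop (omega_concat_fun l sigma) (omega_concat_continuous l Hl sigma)
    (omega_concat_0 l sigma) (omega_concat_1 l sigma).

(* The proof [Hl] only makes [omega_concat] a well-defined loop. *)
Definition deeply_concatenable {X : Type} {tX : topology X} {x : X}
  (K : pi1 tX x -> Prop) (l : nat -> loop tX x) : Prop :=
  exists Hl : loops_shrink l,
    forall sigma : cantor, K (loop_class (omega_concat l Hl sigma)).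

(* Main.v *)
(* Let f(sigma) be the (infinite) product coded by sigma, and A_m the set of
   all sigma with L (f sigma) <= m.  By the Baire category theorem some A_m is
   nonmeager, hence, having the Baire property, comeager in a cylinder given by
   a word s of some length k.  For n >= k, flipping the n-th digit is a
   homeomorphism, so some sigma extending s 0^(n-k) 0 lies in A_m together with
   its flip sigma'.  If p is the finite product coded by s, then
   f(sigma') = (p g_n p^-1) f(sigma), so L (g_n) <= 2 m + 2 L (p), a bound
   that does not depend on n. *)
Require Import Defs.
From Stdlib Require Import Reals.
From Stdlib Require Import Lra Lia List Classical Cantor FunctionalExtensionality.
Open Scope R_scope.

(** * Category in the Cantor space *)

Lemma finite_choice {X : Type} (P : nat -> X -> Prop) (n : nat) :
  (forall m, exists x, P m x) ->
  exists f : nat -> X, forall m, (m < n)%nat -> P m (f m).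
Proof.
intros H; induction n as [|n [f Hf]].
- destruct (H O) as [x _]; exists (fun _ => x); intros m Hm; lia.
- destruct (H n) as [x Hx].
  exists (fun m => if Nat.eq_dec m n then x else f m); intros m Hm.
  destruct (Nat.eq_dec m n) as [->|]; [exact Hx | apply Hf; lia].
Qed.

Lemma countable_choice (DC : dependent_choice) {X : Type}
  (P : nat -> X -> Prop) :
  (forall n, exists x, P n x) -> exists f : nat -> X, forall n, P n (f n).
Proof.
intros H.
(* A state (n, f) is meant to satisfy P below n; since n increases along a
   chain, no control on its first term is needed. *)
destruct (DC (nat * (nat -> X))%type
  (fun p q => (fst p < fst q)%nat /\
              forall m, (m < fst q)%nat -> P m (snd q m))) as [z Hz].
- destruct (H O) as [x _]; exact (inhabits (O, fun _ => x)).
- intros [n f]; destruct (finite_choice P (S n) H) as [f' Hf'].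
  exists (S n, f'); simpl; split; [lia | exact Hf'].
- assert (Hlt : forall n, (n <= fst (z n))%nat).
  { induction n as [|n IH]; [lia | destruct (Hz n); lia]. }
  (* Successive states may disagree, so the value at [n] is read off [z (S n)], whose first
     component exceeds [n]. *)
  exists (fun n => snd (z (S n)) n); intros n; apply Hz.
  destruct (Hz n); specialize (Hlt n); lia.
Qed.

Definition agree (k : nat) (a b : cantor) : Prop :=
  forall i, (i < k)%nat -> a i = b i.

Lemma open_agree (k : nat) (a : cantor) :
  open cantor_topology (fun b => agree k b a).
Proof.
intros b Hb; exists (seq 0 k), (fun i e => e = b i); repeat split; auto.
intros c Hc i Hi; rewrite <- (Hb i Hi); apply Hc, in_seq; lia.
Qed.

Lemma open_contains_cylinder (U : cantor -> Prop) (a : cantor) :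
  open cantor_topology U -> U a ->
  exists k, forall b, agree k b a -> U b.
Proof.
intros oU Ua; destruct (oU a Ua) as [F [V [_ [Va HV]]]].
exists (S (list_max F)); intros b Hb; apply HV; intros i Hi.
rewrite Hb; [apply Va|].
pose proof (proj1 (list_max_le F (list_max F)) (le_n _)) as HF.
rewrite Forall_forall in HF; specialize (HF i Hi); lia.
Qed.

(** This is nowhere density phrased with finite words; a point together with a length encodes a
    word. *)
Definition cylinder_avoidable (A : cantor -> Prop) : Prop :=
  forall a k, exists b j, (k <= j)%nat /\ agree k b a /\
    forall c, agree j c b -> ~ A c.

(** If every subcylinder met [A], the whole cylinder would lie in the closure of [A], and [a] would
    be an interior point of it. *)
Lemma nowhere_dense_avoidable (A : cantor -> Prop) :
  nowhere_dense cantor_topology A -> cylinder_avoidable A.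
Proof.
intros HA a k.
apply NNPP; intros C; apply (HA a).
exists (fun b => agree k b a); split; [apply open_agree|].
split; [now intros i _|].
intros b Hb U oU Ub; apply NNPP; intros D; apply C.
destruct (open_contains_cylinder U b oU Ub) as [j Hj].
exists b, (max k j); split; [lia|]; split; [exact Hb|].
intros c Hc Ac; apply D; exists c; split; [|exact Ac].
apply Hj; intros i Hi; apply Hc; lia.
Qed.

Lemma avoidable_union (A B : cantor -> Prop) :
  cylinder_avoidable A -> cylinder_avoidable B ->
  cylinder_avoidable (fun c => A c \/ B c).
Proof.
intros HA HB a k.
destruct (HA a k) as [b [j [kj [ba Hb]]]].
destruct (HB b j) as [b' [j' [jj' [bb' Hb']]]].
exists b', j'; split; [lia|]; split.
- intros i Hi; rewrite <- (ba i Hi); apply bb'; lia.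
- intros c Hc [Ac | Bc]; [|now apply (Hb' c)].
  apply (Hb c); [|exact Ac]; intros i Hi.
  rewrite <- (bb' i Hi); apply Hc; lia.
Qed.

Lemma avoidable_finite_union (A : nat -> cantor -> Prop) (n : nat) :
  (forall i, cylinder_avoidable (A i)) ->
  cylinder_avoidable (fun c => exists i, (i <= n)%nat /\ A i c).
Proof.
intros HA; induction n as [|n IH].
- intros a k; destruct (HA O a k) as [b [j [kj [ba Hb]]]].
  exists b, j; repeat split; auto; intros c Hc [i [Hi Ac]].
  replace i with O in Ac by lia; now apply (Hb c).
- intros a k.
  destruct (avoidable_union _ _ IH (HA (S n)) a k) as [b [j [kj [ba Hb]]]].
  exists b, j; repeat split; auto; intros c Hc [i [Hi Ac]].
  apply (Hb c Hc); destruct (Nat.eq_dec i (S n)) as [->|]; [now right|].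
  left; exists i; split; [lia | exact Ac].
Qed.

Lemma baire_category (DC : dependent_choice) (A : nat -> cantor -> Prop)
  (a : cantor) (k : nat) :
  (forall i, cylinder_avoidable (A i)) ->
  exists b, agree k b a /\ forall i, ~ A i b.
Proof.
intros HA.
(* The states are cylinders inside the given one, because dependent choice leaves the first term of
   the chain unspecified. *)
destruct (DC {p : cantor * nat | (k <= snd p)%nat /\ agree k (fst p) a}
  (fun p q =>
     (snd (proj1_sig p) < snd (proj1_sig q))%nat /\
     agree (snd (proj1_sig p)) (fst (proj1_sig q)) (fst (proj1_sig p)) /\
     forall c, agree (snd (proj1_sig q)) c (fst (proj1_sig q)) ->
       forall i, (i <= snd (proj1_sig p))%nat -> ~ A i c)) as [z Hz].
- assert (Ha : (k <= snd (a, k))%nat /\ agree k (fst (a, k)) a)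
    by (split; [apply le_n | now intros i _]).
  exact (inhabits (exist _ (a, k) Ha)).
- intros [[b j] [kj ba]]; cbn [fst snd proj1_sig] in *.
  (* The length [j] doubles as an index bound: lengths strictly increase along the chain, so every
     [A i] is eventually avoided. *)
  destruct (avoidable_finite_union A j HA b (S j)) as [b' [j' [jj' [bb' Hb']]]].
  assert (H' : (k <= snd (b', j'))%nat /\ agree k (fst (b', j')) a).
  { split; cbn [fst snd]; [lia|]; intros i Hi.
    rewrite <- (ba i Hi); apply bb'; lia. }
  exists (exist _ (b', j') H'); cbn [fst snd proj1_sig].
  split; [lia|]; split; [intros i Hi; apply bb'; lia|].
  intros c Hc i Hi Ac; apply (Hb' c Hc); now exists i.
- set (s := fun n => fst (proj1_sig (z n))) in *.
  set (h := fun n => snd (proj1_sig (z n))) in *.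
  assert (Hh : forall n, (n <= h n)%nat).
  { induction n as [|n IH]; [lia|]; destruct (Hz n) as [Hn _].
    fold (h n) (h (S n)) in Hn; lia. }
  assert (Hmono : forall m n, (m <= n)%nat ->
             (h m <= h n)%nat /\ agree (h m) (s n) (s m)).
  { intros m n Hmn; induction Hmn as [|n Hmn [IH1 IH2]].
    - split; [lia | now intros i _].
    - destruct (Hz n) as [Hn [Hn' _]].
      fold (h n) (h (S n)) (s n) (s (S n)) in Hn, Hn'; split; [lia|].
      intros i Hi; rewrite <- (IH2 i Hi); apply Hn'; lia. }
  (* Stage [S i] has fixed more than [i] digits, so its digit [i] is final. *)
  set (b := fun i => s (S i) i).
  assert (Hb : forall n, agree (h n) b (s n)).
  { intros n i Hi; unfold b.
    destruct (Nat.le_ge_cases n (S i)) as [le | ge].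
    - now apply Hmono.
    - symmetry; apply (Hmono (S i) n ge); specialize (Hh (S i)); lia. }
  exists b; split.
  + destruct (proj2_sig (z O)) as [k0 a0]; fold (h O) (s O) in k0, a0.
    intros i Hi; rewrite (Hb O) by lia; now apply a0.
  + intros i; destruct (Hz i) as [_ [_ Hi]].
    apply (Hi b (Hb (S i))); apply Hh.
Qed.

Definition flip (n : nat) (a : cantor) : cantor :=
  fun i => if Nat.eq_dec i n then negb (a i) else a i.

Lemma flip_invol (n : nat) (a : cantor) (i : nat) : flip n (flip n a) i = a i.
Proof.
unfold flip; destruct (Nat.eq_dec i n); auto; apply Bool.negb_involutive.
Qed.

Lemma agree_flip (n k : nat) (a b : cantor) :
  agree k a b -> agree k (flip n a) (flip n b).
Proof. intros H i Hi; unfold flip; now rewrite H. Qed.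

Lemma agree_flip_l (n k : nat) (a b : cantor) :
  agree k a (flip n b) -> agree k (flip n a) b.
Proof.
intros H i Hi; rewrite <- (flip_invol n b i); now apply (agree_flip n k).
Qed.

(** The flip is an involution carrying cylinders to cylinders of the same length. *)
Lemma flip_avoidable (n : nat) (A : cantor -> Prop) :
  cylinder_avoidable A -> cylinder_avoidable (fun c => A (flip n c)).
Proof.
intros HA a k; destruct (HA (flip n a) k) as [b [j [kj [ba Hb]]]].
exists (flip n b), j; split; [exact kj|]; split; [now apply agree_flip_l|].
intros c Hc; apply Hb; now apply agree_flip_l.
Qed.

(** Padding with zeros makes all later factors trivial, so prolonging the word to length [n] leaves
    its finite product unchanged. *)
Definition truncate (k : nat) (a : cantor) : cantor :=
  fun i => if Nat.ltb i k then a i else false.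

(** The category part of the argument, for arbitrary sets [P m] covering the space. Prescribing
    [S n] digits forces digit [n] to be 0, so the flip inserts exactly one factor. *)
Lemma uniform_level_flip (DC : dependent_choice) (BP : all_cantor_baire)
  (P : nat -> cantor -> Prop) :
  (forall a, exists m, P m a) ->
  exists (m : nat) (s : cantor) (k : nat), forall n, (k <= n)%nat ->
    exists a, agree (S n) a (truncate k s) /\ P m a /\ P m (flip n a).
Proof.
intros cover.
destruct (countable_choice DC
  (fun m (w : (cantor -> Prop) * (nat -> cantor -> Prop)) =>
     open cantor_topology (fst w) /\
     (forall j, cylinder_avoidable (snd w j)) /\
     forall a, symmetric_difference (P m) (fst w) a ->
       exists j, snd w j a)) as [w Hw].
{ intros m; destruct (BP (P m)) as [U [oU [N [HN E]]]].
  exists (U, N); split; [exact oU|]; split.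
  - intros j; apply nowhere_dense_avoidable, HN.
  - intros a Ha; now apply E. }
assert (Hne : exists m s, fst (w m) s).
{ apply NNPP; intros C.
  (* If all the open sets were empty, the exceptional sets of all the [P m], enumerated by the
     Cantor pairing, would cover the space. *)
  destruct (baire_category DC
    (fun i => snd (w (fst (of_nat i))) (snd (of_nat i))) (fun _ => false) O)
    as [a [_ Ha]]; [intros i; apply Hw|].
  destruct (cover a) as [m Pa]; destruct (Hw m) as [_ [_ E]].
  destruct (E a) as [j Hj].
  { left; split; [exact Pa|]; intros Ua; apply C; now exists m, a. }
  apply (Ha (to_nat (m, j))); now rewrite cancel_of_to. }
destruct Hne as [m [s Us]]; destruct (Hw m) as [oU [HN E]].
destruct (open_contains_cylinder _ s oU Us) as [k Hk].
exists m, s, k; intros n Hn.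
(* Avoiding the exceptional sets and their preimages under the flip puts both the point and its flip
   in [P m]. *)
destruct (baire_category DC
  (fun j c => snd (w m) j c \/ snd (w m) j (flip n c)) (truncate k s) (S n))
  as [a [Ha avoid]].
{ intros j; apply avoidable_union; [|apply flip_avoidable]; apply HN. }
assert (HP : forall c, (forall j, ~ snd (w m) j c) -> agree k c s -> P m c).
{ intros c Hc Hs; apply NNPP; intros C.
  destruct (E c) as [j Hj]; [right; split; auto | now apply (Hc j)]. }
assert (Has : agree k a s).
{ intros i Hi; rewrite Ha by lia; unfold truncate.
  now rewrite (proj2 (Nat.ltb_lt i k) Hi). }
exists a; split; [exact Ha|]; split; apply HP; auto.
- intros j Hj; apply (avoid j); now left.
- intros j Hj; apply (avoid j); now right.
- intros i Hi; unfold flip; destruct (Nat.eq_dec i n); [lia | auto].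
Qed.

(** * Partial products and length functions *)

Lemma partial_product_agree {G : group} (g : nat -> G) (a b : cantor)
  (n : nat) : agree n a b -> partial_product g a n = partial_product g b n.
Proof.
induction n as [|n IH]; intros H; [reflexivity|]; simpl.
rewrite H by lia; rewrite IH; [reflexivity|]; intros i Hi; apply H; lia.
Qed.

Lemma partial_product_truncate {G : group} (g : nat -> G) (a : cantor)
  (k n : nat) : (k <= n)%nat ->
  partial_product g (truncate k a) n = partial_product g (truncate k a) k.
Proof.
induction 1 as [|n Hn IH]; [reflexivity|]; simpl; rewrite IH.
unfold truncate at 2; rewrite (proj2 (Nat.ltb_ge n k) Hn); apply gop_1_r.
Qed.

Lemma bounded_of_bounded_tail (u : nat -> R) (k : nat) (B : R) :
  (forall n, (k <= n)%nat -> u n <= B) -> exists M, forall n, u n <= M.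
Proof.
revert B; induction k as [|k IH]; intros B H.
- exists B; intros n; apply H; lia.
- apply (IH (Rmax B (u k))); intros n Hn.
  destruct (Nat.eq_dec n k) as [->|]; [apply Rmax_r|].
  apply Rle_trans with B; [apply H; lia | apply Rmax_l].
Qed.

Definition gconj {G : group} (p h : G) : G := gop (gop p h) (ginv p).

(** Inserting [h] between a prefix [p] and a remainder [r] amounts to a left factor independent of
    [r], a form that makes sense for infinite products too. *)
Lemma gconj_mul {G : group} (p h r : G) :
  gop (gconj p h) (gop p r) = gop p (gop h r).
Proof.
unfold gconj.
now rewrite <- !gop_assoc, (gop_assoc _ (ginv p) p r), gop_inv_l, gop_1_l.
Qed.

(** Cancelling [y] and undoing the conjugation writes [h] in terms of elements of controlled
    length. *)
Lemma gconj_ratio {G : group} (p h y z : G) :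
  z = gop (gconj p h) y -> h = gop (ginv p) (gop (gop z (ginv y)) p).
Proof.
intros ->; rewrite <- (gop_assoc _ (gconj p h)), gop_inv_r, gop_1_r.
unfold gconj; rewrite <- !gop_assoc, gop_inv_l, gop_1_r, gop_assoc, gop_inv_l.
symmetry; apply gop_1_l.
Qed.

(* [F] is the graph of sigma |-> f(sigma); it is a relation because choosing
   the values would require unique choice. *)
Lemma bounded_of_flip (DC : dependent_choice) (BP : all_cantor_baire)
  (G : group) (g : nat -> G) (F : cantor -> G -> Prop) :
  (forall a, exists y, F a y) ->
  (forall a n y z, a n = false -> F a y -> F (flip n a) z ->
     z = gop (gconj (partial_product g a n) (g n)) y) ->
  forall L : G -> R, length_function G L ->
  exists M, forall n, L (g n) <= M.
Proof.
intros total Hflip L [_ _ Linv Lop].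
destruct (uniform_level_flip DC BP
  (fun m a => exists y, F a y /\ L y <= INR m)) as [m [s [k H]]].
{ intros a; destruct (total a) as [y Fy]; destruct (INR_unbounded (L y)) as [m Hm].
  exists m, y; split; [exact Fy | lra]. }
set (p := partial_product g (truncate k s) k).
apply (bounded_of_bounded_tail _ k (2 * INR m + 2 * L p)); intros n Hn.
destruct (H n Hn) as [a [Ha [[y [Fy Ly]] [z [Fz Lz]]]]].
assert (an : a n = false).
{ rewrite Ha by lia; unfold truncate; now rewrite (proj2 (Nat.ltb_ge n k) Hn). }
assert (Ep : partial_product g a n = p).
{ rewrite (partial_product_agree g a (truncate k s));
    [now apply partial_product_truncate | intros i Hi; apply Ha; lia]. }
pose proof (Hflip a n y z an Fy Fz) as E; rewrite Ep in E.
rewrite (gconj_ratio _ _ _ _ E).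
pose proof (Lop (ginv p) (gop (gop z (ginv y)) p)).
pose proof (Lop (gop z (ginv y)) p); pose proof (Lop z (ginv y)).
rewrite <- Linv in *; lra.
Qed.

(** * Topological groups *)

(** At [N = n + 1] the remainder after the inserted factor is trivial; each later step appends the
    same factor on the right of both sides. *)
Lemma partial_product_flip {G : group} (g : nat -> G) (a : cantor)
  (n N : nat) : a n = false -> (n < N)%nat ->
  partial_product g (flip n a) N =
  gop (gconj (partial_product g a n) (g n)) (partial_product g a N).
Proof.
intros an; induction 1 as [|N HN IH]; cbn [partial_product].
- rewrite an, gconj_mul, gop_1_r.
  unfold flip at 2; destruct (Nat.eq_dec n n); [|contradiction].
  rewrite an; cbn [negb]; f_equal; apply partial_product_agree.
  intros i Hi; unfold flip; destruct (Nat.eq_dec i n); [lia | auto].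
- rewrite IH, gop_assoc; unfold flip.
  destruct (Nat.eq_dec N n); [lia | reflexivity].
Qed.

Lemma converges_unique {T : Type} (tau : topology T) (u : nat -> T) (y z : T) :
  hausdorff tau -> converges tau u y -> converges tau u z -> y = z.
Proof.
intros Hd Hy Hz; apply NNPP; intros C.
destruct (Hd y z C) as [U [V [oU [oV [Uy [Vz D]]]]]].
destruct (Hy U oU Uy) as [N HN], (Hz V oV Vz) as [N' HN'].
apply (D (u (max N N'))); split; [apply HN | apply HN']; lia.
Qed.

Lemma left_mul_continuous {G : group} (tau : topology G) (c : G) :
  topological_group G tau -> continuous tau tau (gop c).
Proof.
intros [cmul _].
apply (continuous_comp _ _ _ (fun y => (c, y)) _) with (2 := cmul).
apply continuous_pair; [|apply continuous_id].
intros U HU; apply open_local; intros y Uc.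
exists (fun _ => True); repeat split; auto using open_full.
Qed.

(** * Fundamental groups *)

Lemma homotopic_ext {X : Type} {tX : topology X} {x : X} (a b : loop tX x) :
  (forall t, a t = b t) -> homotopic a b.
Proof.
intros E; apply (homotopic_reparam a a b (@proj1_sig _ _) (@proj1_sig _ _));
  auto with cont; intros t; rewrite clamp_proj; auto.
Qed.

Lemma loops_shrink_tail {X : Type} {tX : topology X} {x : X}
  (l : nat -> loop tX x) :
  loops_shrink l -> loops_shrink (fun n => l (S n)).
Proof.
intros Hl U oU Ux; destruct (Hl U oU Ux) as [N HN].
exists N; intros n Hn; apply HN; lia.
Qed.

(** The subdivision is self-similar: [2 t - 1] maps its interval of index [m + 1] onto that of index
    [m]. The two loops even agree pointwise. *)
Lemma omega_concat_unfold {X : Type} {tX : topology X} {x : X}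
  (l : nat -> loop tX x) (Hl : loops_shrink l)
  (Hl' : loops_shrink (fun n => l (S n))) (a : cantor) :
  homotopic (omega_concat l Hl a)
    (Defs.concat (loop_pow (l O) (a O))
                 (omega_concat (fun n => l (S n)) Hl' (fun n => a (S n)))).
Proof.
apply homotopic_ext; intros t.
cbn [omega_concat Defs.concat loop_fun].
destruct t as [t Ht]; cbn [proj1_sig].
destruct (Rle_dec t (1 / 2)) as [le | gt].
- rewrite (omega_concat_spec l a O) by (cbn [proj1_sig]; simpl; lra).
  cbn [proj1_sig]; do 2 f_equal; simpl; ring.
(* The end point lies in no interval of the subdivision; both loops take the value [x] there. *)
- destruct (Req_dec t 1) as [-> | ne].
  + replace (2 * 1 - 1) with 1 by ring; rewrite omega_concat_1.
    replace (exist _ 1 Ht : unit_interval) with (clamp 1)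
      by exact (sig_eq (clamp 1) (exist _ 1 Ht) (clamp_val 1 ltac:(lra))).
    apply omega_concat_1.
  + assert (lt1 : 2 * t - 1 < 1) by lra.
    destruct (piece_spec (2 * t - 1) lt1) as [Hm _]; [lra|].
    set (m := piece (2 * t - 1) lt1) in *; clearbody m.
    assert (E : forall j, 2 * (1 / 2 ^ S j) = 1 / 2 ^ j).
    { intros j; simpl; field; apply pow_nonzero; lra. }
    pose proof (E m); pose proof (E (S m)).
    rewrite (omega_concat_spec l a (S m)) by (cbn [proj1_sig]; lra).
    rewrite (omega_concat_spec (fun n => l (S n)) (fun n => a (S n)) m)
      by (rewrite clamp_val; lra).
    rewrite clamp_val by lra; cbn [proj1_sig]; do 2 f_equal.
    change (2 ^ S (S m)) with (2 * 2 ^ S m); ring.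
Qed.

(** Serves to pull the first factor [c] out of a flip at a later position. *)
Lemma gconj_shift {G : group} (c p h y : G) :
  gop (gconj (gop c p) h) (gop c y) = gop c (gop (gconj p h) y).
Proof.
assert (E : gop c y = gop (gop c p) (gop (ginv p) y)).
{ now rewrite <- gop_assoc, (gop_assoc _ p), gop_inv_r, gop_1_l. }
rewrite E, gconj_mul; unfold gconj; now rewrite <- !gop_assoc.
Qed.

(** Partial products grow on the right, whereas unfolding an infinite concatenation removes its
    first loop on the left. *)
Lemma partial_product_shift {G : group} (g : nat -> G) (a : cantor) (n : nat) :
  partial_product g a (S n) =
  gop (if a O then g O else gone)
      (partial_product (fun k => g (S k)) (fun k => a (S k)) n).
Proof.
induction n as [|n IH].
- simpl; now rewrite gop_1_l, gop_1_r.
- change (partial_product g a (S (S n))) with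
    (gop (partial_product g a (S n)) (if a (S n) then g (S n) else gone)).
  rewrite IH; simpl; now rewrite gop_assoc.
Qed.

(** In place of a limit, an induction on [n] peels off the first loop, with the sequence and the
    word generalized. At [n = 0] the flip replaces a constant first loop by [l 0]. *)
Lemma omega_concat_flip {X : Type} {tX : topology X} {x : X} (n : nat) :
  forall (l : nat -> loop tX x) (Hl : loops_shrink l) (a : cantor),
  a n = false ->
  (loop_class (omega_concat l Hl (flip n a)) : pi1 tX x) =
  gop (gconj (partial_product (fun k => loop_class (l k) : pi1 tX x) a n)
             (loop_class (l n)))
      (loop_class (omega_concat l Hl a)).
Proof.
assert (unfold_class : forall (l : nat -> loop tX x) (Hl : loops_shrink l) a,
  (loop_class (omega_concat l Hl a) : pi1 tX x) =
  gop (if a O then (loop_class (l O) : pi1 tX x) else gone)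
      (loop_class (omega_concat (fun k => l (S k)) (loops_shrink_tail l Hl)
                     (fun k => a (S k))))).
{ intros l Hl a.
  rewrite (proj2 (loop_class_eq _ _)
    (omega_concat_unfold l Hl (loops_shrink_tail l Hl) a)).
  simpl; rewrite <- pi1_op_class; now destruct (a O). }
induction n as [|n IH]; intros l Hl a an.
- rewrite (unfold_class l Hl a), (unfold_class l Hl (flip O a)), an.
  simpl partial_product; rewrite gconj_mul, gop_1_l.
  unfold flip at 1; simpl; now rewrite an.
- assert (Et : (fun k => flip (S n) a (S k)) = flip n (fun k => a (S k))).
  { apply functional_extensionality; intros k; unfold flip.
    destruct (Nat.eq_dec (S k) (S n)), (Nat.eq_dec k n); auto; lia. }
  rewrite (unfold_class l Hl a), (unfold_class l Hl (flip (S n) a)).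
  rewrite Et, (IH _ _ (fun k => a (S k)) an).
  now rewrite partial_product_shift, gconj_shift.
Qed.

Lemma partial_product_subgroup {G : group} (K : G -> Prop)
  (HK : is_subgroup G K) (g : nat -> subgroup G K HK) (a : cantor) (n : nat) :
  proj1_sig (partial_product g a n) =
  partial_product (fun k => proj1_sig (g k)) a n.
Proof.
induction n as [|n IH]; [reflexivity|]; simpl; rewrite IH.
now destruct (a n).
Qed.

Theorem theorem2
  (DC : dependent_choice)
  (BP : all_cantor_baire) :
  (forall (G : group) (tau : topology G),
     topological_group G tau -> hausdorff tau ->
     forall g : nat -> G, searrow_1 G tau g ->
     forall L : G -> R, length_function G L ->
     exists M : R, forall n : nat, L (g n) <= M)
  /\
  (forall (X : Type) (tX : topology X) (x : X) (l : nat -> loop tX x)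
     (K : pi1 tX x -> Prop) (HK : is_subgroup (pi1 tX x) K),
     deeply_concatenable K l ->
     forall L : subgroup (pi1 tX x) K HK -> R,
     length_function (subgroup (pi1 tX x) K HK) L ->
     exists M : R, forall n : nat,
       exists Hn : K (loop_class (l n)),
         L (exist K (loop_class (l n)) Hn) <= M).
Proof.
split.
- intros G tau HG Hd g Hg.
  apply (bounded_of_flip DC BP G g
    (fun a y => converges tau (partial_product g a) y)); [exact Hg|].
  intros a n y z an Hy Hz.
  (* Past stage [n] the flipped products are a fixed left translate of the original ones, so they
     converge to that translate of [y]. *)
  apply (converges_unique tau _ _ _ Hd Hz); intros U oU Uy.
  destruct (Hy _ (left_mul_continuous tau _ HG U oU) Uy) as [N HN].
  exists (max N (S n)); intros i Hi.
  rewrite partial_product_flip by (auto; lia); apply HN; lia.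
- intros X tX x l K HK [Hl HlK] L HL.
  (* Comparing the zero word with its flip at [n] expresses the class of [l n] through two infinite
     concatenations, which lie in [K]. *)
  assert (Kl : forall n, K (loop_class (l n))).
  { intros n; set (o := (fun _ => false) : cantor).
    (* The zero word is convertible to its own truncation at 0. *)
    assert (p1 : partial_product (fun k => loop_class (l k) : pi1 tX x) o n
                 = gone) by exact (partial_product_truncate _ o O n (Nat.le_0_l n)).
    pose proof (gconj_ratio _ _ _ _ (omega_concat_flip n l Hl o eq_refl)) as E.
    rewrite p1 in E; rewrite E.
    repeat apply (subgroup_op HK); try apply (subgroup_inv HK); auto;
      apply (subgroup_1 HK). }
  set (g := fun n => exist K (loop_class (l n)) (Kl n)
              : subgroup (pi1 tX x) K HK).
  destruct (bounded_of_flip DC BP _ g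
    (fun a y => proj1_sig y = loop_class (omega_concat l Hl a))) with (L := L)
    as [M HM]; auto.
  + intros a; now exists (exist K _ (HlK a)).
  + intros a n y z an Hy Hz; apply sig_eq.
    rewrite Hz, (omega_concat_flip n l Hl a an), <- Hy.
    pose proof (partial_product_subgroup K HK g a n) as E.
    change (fun k => proj1_sig (g k)) with
      (fun k => loop_class (l k) : pi1 tX x) in E.
    now rewrite <- E.
  + exists M; intros n; exists (Kl n); apply HM.
Qed.
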